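(* Let $n_a\ge 1$ be an integer, let $U\in\mathbb{C}^{n_a\times n_a}$ be unitary, let $\mathbf{y}\in[0,1]^{n_a}$, and let $\mathbf{a}^*\in\mathbb{C}^{n_a}$ be such that $|U\mathbf{a}^*|^2=\mathbf{y}$. Let $T=T_{U,\mathbf{y}}$ be the set-valued fixed point operator of the COPR algorithm defined in the context. Then every sequence $(\mathbf{a}_k)_{k\ge 0}$ with $\mathbf{a}_{k+1}\in T(\mathbf{a}_k)$ for all $k$ whose starting point $\mathbf{a}_0$ is sufficiently close to $\mathbf{a}^*$ converges linearly to a point $\tilde{\mathbf{a}}\in\operatorname{Fix}T$ satisfying $|U\tilde{\mathbf{a}}|^2=\mathbf{y}$. That is, there is $\varepsilon>0$ such that this holds for every such sequence with $\|\mathbf{a}_0-\mathbf{a}^*\|<\varepsilon$.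
   Context: For a vector $\mathbf{v}$, $|\mathbf{v}|^2$ denotes the vector of entrywise squared moduli, $\operatorname{diag}(\mathbf{v})$ the diagonal matrix with the entries of $\mathbf{v}$ on its diagonal, and $\overline{\mathbf{v}}$ the entrywise complex conjugate. $\|\cdot\|_*$ is the nuclear norm of a matrix (sum of its singular values), and $\|\cdot\|$ is the Euclidean norm on $\mathbb{C}^{n_a}$. For $U\in\mathbb{C}^{n_y\times n_a}$, $\mathbf{x},\mathbf{b}\in\mathbb{C}^{n_a}$ and $\mathbf{y}\in\mathbb{R}_+^{n_y}$ (here $n_y=n_a$), define the $2n_y\times 2n_y$ complex matrix $$M(U,\mathbf{x},\mathbf{b},\mathbf{y})=\begin{pmatrix} C+AY+XB+XY & A+X\\ B+Y & I_{n_y}\end{pmatrix},$$ where $A=\operatorname{diag}(\overline{U\mathbf{x}})$, $B=\operatorname{diag}(U\mathbf{x})$, $C=\operatorname{diag}(\mathbf{y})$, $X=\operatorname{diag}(\overline{U\mathbf{b}})$, $Y=\operatorname{diag}(U\mathbf{b})$. The (set-valued) operator $T$ on $\mathbb{C}^{n_a}$ is $$T(\mathbf{a})=\arg\min_{\mathbf{x}\in\mathbb{C}^{n_a}}\|M(U,\mathbf{x},-\mathbf{a},\mathbf{y})\|_*,$$ the set of all global minimizers, and $\operatorname{Fix}T=\{\mathbf{a}\in\mathbb{C}^{n_a}: \mathbf{a}\in T(\mathbf{a})\}$. The iteration $\mathbf{a}_{k+1}\in T(\mathbf{a}_k)$ (Picard iteration) is the COPR algorithm. Linear convergence of $(\mathbf{a}_k)$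 to $\tilde{\mathbf{a}}$ means at least linear convergence: there exist $K\ge 0$ and $c\in(0,1)$ with $\|\mathbf{a}_k-\tilde{\mathbf{a}}\|\le K c^k$ for all $k$. *)

(* Defs.v *)
From HB Require Import structures.
From mathcomp Require Import all_boot all_order all_algebra.
From mathcomp Require Import complex.
From mathcomp Require Import classical_sets reals.

Set Implicit Arguments.
Unset Strict Implicit.
Unset Printing Implicit Defensive.

Import Order.TTheory GRing.Theory Num.Theory.
Local Open Scope ring_scope.
Local Open Scope complex_scope.
Local Open Scope sesquilinear_scope.
Local Open Scope classical_set_scope.

Section Copr.
Variable R : realType.
Local Notation C := R[i].

Definition abs2 (n : nat) (v : 'cV[C]_n) : 'cV[R]_n :=
  map_mx (fun z => Normc.normc z ^+ 2) v.

Definition l2norm (n : nat) (v : 'cV[C]_n) : R :=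
  Num.sqrt (\sum_i Normc.normc (v i ord0) ^+ 2).

(* Square roots of the eigenvalues, with multiplicity, of the Gram matrix of A;
   these eigenvalues are real and nonnegative, so complex.Re loses nothing.
   When m < n, the list is padded with n - m zeros. *)
Definition singular_values (m n : nat) (A : 'M[C]_(m, n)) : 'rV[R]_n :=
  map_mx (fun z => Num.sqrt (complex.Re z)) (spectral_diag (A ^t* *m A)).

Definition nuclear_norm (m n : nat) (A : 'M[C]_(m, n)) : R :=
  \sum_i singular_values A ord0 i.

Definition diagc (n : nat) (v : 'cV[C]_n) : 'M[C]_n := diag_mx v^T.

Definition conjv (n : nat) (v : 'cV[C]_n) : 'cV[C]_n := map_mx Num.conj v.

Definition copr_mx (ny na : nat) (U : 'M[C]_(ny, na)) (x b : 'cV[C]_na)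
    (y : 'cV[R]_ny) : 'M[C]_(ny + ny) :=
  let A := diagc (conjv (U *m x)) in
  let B := diagc (U *m x) in
  let D := diagc (map_mx (real_complex R) y) in
  let X := diagc (conjv (U *m b)) in
  let Y := diagc (U *m b) in
  block_mx (D + A *m Y + X *m B + X *m Y) (A + X)
           (B + Y)                        1%:M.

Definition copr_op (ny na : nat) (U : 'M[C]_(ny, na)) (y : 'cV[R]_ny)
    (a : 'cV[C]_na) : set 'cV[C]_na :=
  [set x | forall z : 'cV[C]_na,
     nuclear_norm (copr_mx U x (- a) y) <= nuclear_norm (copr_mx U z (- a) y)].

Definition Fix (V : Type) (T : V -> set V) : set V := [set a | T a a].

Definition picard_seq (V : Type) (T : V -> set V) (a : nat -> V) : Prop :=
  forall k, T (a k) (a k.+1).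

Definition converges_linearly (n : nat) (a : nat -> 'cV[C]_n) (l : 'cV[C]_n) :
    Prop :=
  exists K c : R, [/\ 0 <= K, 0 < c < 1 &
    forall k, l2norm (a k - l) <= K * c ^+ k].

End Copr.

(* Main.v *)
Require Import Defs.
From mathcomp Require Import all_boot all_order all_algebra.
From mathcomp Require Import complex.
From mathcomp Require Import classical_sets reals.
From mathcomp Require Import ring lra.

Import Order.TTheory GRing.Theory Num.Theory.
Local Open Scope ring_scope.
Local Open Scope complex_scope.

(** Why the iteration converges.

    All four blocks of [copr_mx U x (- a) y] are diagonal, so after a
    permutation of the rows and columns it is a direct sum of 2x2 matrices, one
    for each measurement.  With u, v, t the i-th entries of U x, U a, y, the
    i-th 2x2 matrix is Hermitian with diagonal p, 1 and off-diagonal entry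
    u - v, where p = t + |v|^2 - 2 Re(conj(u) v); its determinant is
    t - |u|^2.  The nuclear norm is therefore a sum of one-coordinate costs
    ([nuclear_norm_copr_mx]), and since U is unitary the coordinates of U x can
    be minimized independently ([copr_opP]).

    The one-coordinate problem is explicit ([coord_cost_step_lt]).  The cost is
    1 + p inside the circle |u|^2 = t, and the square root of
    (1 - p)^2 + 4 |u - v|^2 outside of it.
    - If t = 0, only the second regime occurs, and its unique minimizer is v / 2.
    - If t > 0 and |v| is close to sqrt t, then 1 + p decreases towards the
      circle in the direction of v, while the second expression increases on
      leaving it; the unique minimizer is the radial projection of v on the
      circle.

    Thus every coordinate of U a_k with y_i > 0 is projected on its circle by
    the first iteration and stays put from then on, while the coordinates with
    y_i = 0 are halved by each iteration: the convergence is linear with rate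
    1/2 ([near_circle_step]), and the limit is a fixed point on all the circles
    ([coord_limit_fixed]). *)

Set Implicit Arguments.
Unset Strict Implicit.
Unset Printing Implicit Defensive.

Local Open Scope sesquilinear_scope.

Local Notation normc := Normc.normc.

(** * The real plane underlying the complex numbers *)

(** The real inner product Re(conj(u) v). *)
Definition cdot (R : realType) (u v : R[i]) : R :=
  complex.Re u * complex.Re v + complex.Im u * complex.Im v.

Lemma normc_ge0 (R : realType) (z : R[i]) : 0 <= normc z.
Proof. by case: z => x y; exact: sqrtr_ge0. Qed.

Lemma normc_normE (R : rcfType) (z : R[i]) : (normc z)%:C = `|z|.
Proof. by []. Qed.

Lemma conjE (R : rcfType) (a b : R) : Num.conj (a +i* b) = a -i* b.
Proof. by []. Qed.

Lemma normc_real (R : realType) (x : R) : normc x%:C = `|x|.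
Proof. by rewrite /= expr0n addr0 sqrtr_sqr. Qed.

Lemma normc_conj (R : realType) (z : R[i]) : normc (Num.conj z) = normc z.
Proof. by case: z => x y; rewrite /= sqrrN. Qed.

Lemma sqr_normcE (R : rcfType) (z : R[i]) :
  ((normc z) ^+ 2)%:C = Num.conj z * z.
Proof. by rewrite rmorphXn /= -normCKC. Qed.

Lemma sqr_normc_cdot (R : realType) (z : R[i]) : normc z ^+ 2 = cdot z z.
Proof. by case: z => x y; rewrite /= sqr_sqrtr // addr_ge0 ?sqr_ge0. Qed.

Lemma cdot_gt0 (R : realType) (z : R[i]) : z != 0 -> 0 < cdot z z.
Proof.
move=> z_neq0; rewrite -sqr_normc_cdot exprn_gt0 // lt0r normc_ge0 andbT.
by apply: contraNneq z_neq0 => /Normc.eq0_normc ->.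
Qed.

Lemma cdotC (R : realType) (u v : R[i]) : cdot u v = cdot v u.
Proof. by rewrite /cdot; ring. Qed.

Lemma cdotZl (R : realType) (k : R) (u v : R[i]) :
  cdot (k%:C * u) v = k * cdot u v.
Proof. by case: u v => [u1 u2] [v1 v2]; rewrite /cdot /=; ring. Qed.

Lemma cdotBB (R : realType) (u v : R[i]) :
  cdot (u - v) (u - v) = cdot u u - 2 * cdot u v + cdot v v.
Proof. by case: u v => [u1 u2] [v1 v2]; rewrite /cdot /=; ring. Qed.

(** * Nuclear norm of a 2x2 block matrix with diagonal blocks *)

(** The blocks commute, so right multiplication by the block lower triangular
    matrix with diagonal d, 1 and corner - c makes the matrix block upper
    triangular; the extra factor [\det (diag_mx d)] then cancels. *)
Lemma det_block_diag_mx (D : idomainType) (n : nat) (a b c d : 'rV[D]_n) :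
  (forall i, d 0 i != 0) ->
  \det (block_mx (diag_mx a) (diag_mx b) (diag_mx c) (diag_mx d)) =
  \prod_i (a 0 i * d 0 i - b 0 i * c 0 i).
Proof.
move=> d_neq0.
have det_d : \det (diag_mx d) != 0 by rewrite det_diag; apply/prodf_neq0.
pose e := \row_i (a 0 i * d 0 i - b 0 i * c 0 i).
have block_elim : block_mx (diag_mx a) (diag_mx b) (diag_mx c) (diag_mx d) *m
    block_mx (diag_mx d) 0 (- diag_mx c) 1%:M =
    block_mx (diag_mx e) (diag_mx b) 0 (diag_mx d).
  rewrite mulmx_block !mulmx0 !mulmx1 !add0r !mulmxN !mulmx_diag -!raddfB.
  congr block_mx.
    by congr diag_mx; apply/rowP => i; rewrite !mxE.
  by rewrite -[RHS](raddf0 diag_mx); congr diag_mx; apply/rowP => i;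
    rewrite !mxE mulrC subrr.
have := congr1 determinant block_elim.
rewrite det_mulmx det_lblock det1 mulr1 det_ublock => /(mulIf det_d) ->.
by rewrite det_diag; apply: eq_bigr => i _; rewrite mxE.
Qed.

Lemma char_poly_block_diag_mx (D : idomainType) (n : nat) (a b c d : 'rV[D]_n) :
  char_poly (block_mx (diag_mx a) (diag_mx b) (diag_mx c) (diag_mx d)) =
  \prod_i (('X - (a 0 i)%:P) * ('X - (d 0 i)%:P) - (b 0 i * c 0 i)%:P).
Proof.
rewrite /char_poly /char_poly_mx.
rewrite map_block_mx !map_diag_mx scalar_mx_block opp_block_mx add_block_mx.
rewrite !add0r -diag_const_mx -!raddfN -!raddfD det_block_diag_mx.
  by apply: eq_bigr => i _; rewrite !mxE !raddfN /= mulrNN -polyCM.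
by move=> i; rewrite !mxE raddfN polyXsubC_eq0.
Qed.

Lemma char_poly_invmx_conj (D : comUnitRingType) (n : nat) (P A : 'M[D]_n) :
  P \in unitmx -> char_poly (invmx P *m A *m P) = char_poly A.
Proof.
move=> Punit; rewrite /char_poly /char_poly_mx !map_mxM /=.
set Q := map_mx polyC P; set Q' := map_mx polyC (invmx P).
have QQ' : Q' *m Q = 1%:M by rewrite -map_mxM mulVmx // map_mx1.
have conjX : 'X%:M = Q' *m 'X%:M *m Q by rewrite scalar_mxC -mulmxA QQ' mulmx1.
by rewrite {1}conjX -mulmxBl -mulmxBr !det_mulmx mulrAC -det_mulmx QQ' det1 mul1r.
Qed.

(** The singular values of M can be read off the Gram matrix without choosing
    eigenvectors: the spectrum is the list of roots of the characteristic
    polynomial, which factors through the 2x2 matrices (a i, b i; c i, d i).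
    The last two hypotheses say that s i ^ 2 and t i ^ 2 have the trace and the
    determinant of the i-th one. *)
Lemma nuclear_norm_gram (R : realType) (m n : nat) (M : 'M[R[i]]_(m, n + n))
    (a b c d : 'rV[R[i]]_n) (s t : 'I_n -> R) :
  (forall i, 0 <= s i) -> (forall i, 0 <= t i) ->
  M ^t* *m M = block_mx (diag_mx a) (diag_mx b) (diag_mx c) (diag_mx d) ->
  (forall i, a 0 i + d 0 i = (s i ^+ 2 + t i ^+ 2)%:C) ->
  (forall i, a 0 i * d 0 i - b 0 i * c 0 i = ((s i * t i) ^+ 2)%:C) ->
  nuclear_norm M = \sum_i (s i + t i).
Proof.
move=> s_ge0 t_ge0 gramM trG detG.
have gram_normal : M ^t* *m M \is normalmx.
  apply/hermitian_normalmx; apply/is_hermitianmxP.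
  by rewrite expr0 scale1r trmx_mul map_mxM /= trmxCK.
set G := M ^t* *m M in gramM gram_normal.
have charG : char_poly G = \prod_j ('X - (spectral_diag G 0 j)%:P).
  have simG := orthomx_spectralP gram_normal.
  have Punit := unitarymx_unit (spectral_unitarymx G).
  have -> : char_poly G = char_poly (diag_mx (spectral_diag G)).
    by rewrite {1}simG char_poly_invmx_conj.
  rewrite char_poly_trig ?diag_mx_is_trig //.
  by apply: eq_bigr => j _; rewrite mxE eqxx mulr1n.
pose eig := [seq (s i ^+ 2)%:C | i : 'I_n] ++ [seq (t i ^+ 2)%:C | i : 'I_n].
have /prod_XsubC_eq eigE :
    \prod_(x <- [seq spectral_diag G 0 j | j : 'I_(n + n)]) ('X - x%:P) =
    \prod_(x <- eig) ('X - x%:P).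
  rewrite big_image /= -charG gramM char_poly_block_diag_mx.
  rewrite big_cat !big_image /= -big_split /=; apply: eq_bigr => i _.
  transitivity ('X^2 - (a 0 i + d 0 i)%:P * 'X + (a 0 i * d 0 i - b 0 i * c 0 i)%:P).
    by rewrite !polyCD !polyCN !polyCM; ring.
  rewrite trG detG exprMn rmorphD rmorphM /= polyCD polyCM; ring.
rewrite /nuclear_norm /singular_values -/G.
transitivity (\sum_(x <- [seq spectral_diag G 0 j | j : 'I_(n + n)])
    Num.sqrt (complex.Re x)).
  by rewrite big_image /=; apply: eq_bigr => j _; rewrite mxE.
rewrite (perm_big _ eigE) big_cat !big_image /= -big_split /=.
by apply: eq_bigr => i _; rewrite !sqrtr_sqr !ger0_norm.
Qed.

(** The sum of the two singular values of a 2x2 matrix has square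
    (squared Frobenius norm) + 2 |determinant|. *)
Lemma nuclear_norm_block_diag (R : realType) (n : nat) (a b c d : 'rV[R[i]]_n) :
  nuclear_norm (block_mx (diag_mx a) (diag_mx b) (diag_mx c) (diag_mx d)) =
  \sum_i Num.sqrt (normc (a 0 i) ^+ 2 + normc (b 0 i) ^+ 2 +
                   normc (c 0 i) ^+ 2 + normc (d 0 i) ^+ 2 +
                   2 * normc (a 0 i * d 0 i - b 0 i * c 0 i)).
Proof.
pose S i := normc (a 0 i) ^+ 2 + normc (b 0 i) ^+ 2 +
            normc (c 0 i) ^+ 2 + normc (d 0 i) ^+ 2.
pose D i := normc (a 0 i * d 0 i - b 0 i * c 0 i).
have D_ge0 i : 0 <= D i by exact: normc_ge0.
have le_DS i : 2 * D i <= S i.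
  have : D i <= normc (a 0 i) * normc (d 0 i) + normc (b 0 i) * normc (c 0 i).
    by rewrite -lecR rmorphD !rmorphM /= !normc_normE -!normrM ler_normB.
  rewrite /S; move: (D i) => D0.
  have := sqr_ge0 (normc (a 0 i) - normc (d 0 i)).
  have := sqr_ge0 (normc (b 0 i) - normc (c 0 i)).
  nra.
have S_ge0 i : 0 <= S i by rewrite /S !addr_ge0 ?sqr_ge0.
(* N and L are the sum and the difference of the two singular values of the i-th
   2x2 matrix: their squares sum to S i and their product is D i. *)
pose N i := Num.sqrt (S i + 2 * D i).
pose L i := Num.sqrt (S i - 2 * D i).
have N2 i : N i ^+ 2 = S i + 2 * D i.
  by rewrite sqr_sqrtr // addr_ge0 // mulr_ge0.
have L2 i : L i ^+ 2 = S i - 2 * D i by rewrite sqr_sqrtr // subr_ge0.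
have L_ge0 i : 0 <= L i by exact: sqrtr_ge0.
have N_ge0 i : 0 <= N i by exact: sqrtr_ge0.
have le_LN i : L i <= N i by apply: ler_wsqrtr; have := D_ge0 i; lra.
rewrite (@nuclear_norm_gram _ _ _ _
  (\row_i (Num.conj (a 0 i) * a 0 i + Num.conj (c 0 i) * c 0 i))
  (\row_i (Num.conj (a 0 i) * b 0 i + Num.conj (c 0 i) * d 0 i))
  (\row_i (Num.conj (b 0 i) * a 0 i + Num.conj (d 0 i) * c 0 i))
  (\row_i (Num.conj (b 0 i) * b 0 i + Num.conj (d 0 i) * d 0 i))
  (fun i => (N i + L i) / 2) (fun i => (N i - L i) / 2)).
- by apply: eq_bigr => i _; rewrite -/(S i) -/(D i) -/(N i); field.
- by move=> i; rewrite divr_ge0 // addr_ge0.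
- by move=> i; rewrite divr_ge0 // subr_ge0.
- rewrite tr_block_mx map_block_mx !tr_diag_mx !map_diag_mx mulmx_block.
  rewrite !mulmx_diag -!raddfD.
  by congr block_mx; congr diag_mx; apply/rowP => i; rewrite !mxE.
- move=> i; rewrite !mxE.
  have -> : ((N i + L i) / 2) ^+ 2 + ((N i - L i) / 2) ^+ 2 = S i.
    transitivity ((N i ^+ 2 + L i ^+ 2) / 2); first by field.
    by rewrite N2 L2; field.
  by rewrite /S !rmorphD /= !sqr_normcE; ring.
- move=> i; rewrite !mxE.
  have -> : (N i + L i) / 2 * ((N i - L i) / 2) = D i.
    transitivity ((N i ^+ 2 - L i ^+ 2) / 4); first by field.
    by rewrite N2 L2; field.
  rewrite /D sqr_normcE !(rmorphB, rmorphM) /=; ring.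
Qed.

(** * Splitting the cost into coordinates *)

(** Upper left entry p of the i-th 2x2 matrix of the splitting. *)
Definition coord_corner (R : realType) (u v : R[i]) (t : R) : R :=
  t + cdot v v - 2 * cdot u v.

(** Nuclear norm of the i-th 2x2 matrix, whose determinant is t - |u|^2. *)
Definition coord_cost (R : realType) (u v : R[i]) (t : R) : R :=
  Num.sqrt (coord_corner u v t ^+ 2 + 1 + 2 * cdot (u - v) (u - v)
            + 2 * `|t - cdot u u|).

Lemma nuclear_norm_copr_mx (R : realType) (ny na : nat) (U : 'M[R[i]]_(ny, na))
    (x a : 'cV[R[i]]_na) (y : 'cV[R]_ny) :
  nuclear_norm (copr_mx U x (- a) y) =
  \sum_i coord_cost ((U *m x) i 0) ((U *m a) i 0) (y i 0).
Proof.
set u := U *m x; set v := U *m a.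
pose w := u - v.
have -> : copr_mx U x (- a) y =
    block_mx (diag_mx (\row_i (coord_corner (u i 0) (v i 0) (y i 0))%:C))
             (diag_mx (\row_i Num.conj (w i 0)))
             (diag_mx (\row_i w i 0)) (diag_mx (const_mx 1)).
  rewrite /copr_mx mulmxN -/u -/v /diagc diag_const_mx.
  rewrite !mulmx_diag -!raddfD /=.
  clearbody u v.
  congr block_mx; congr diag_mx; apply/rowP => i; rewrite !mxE //=.
  case: (u i 0) (v i 0) => [u1 u2] [v1 v2]; rewrite /coord_corner /cdot /=.
  by rewrite !conjE; simpc; congr (_ +i* _); ring.
clearbody u v.
rewrite nuclear_norm_block_diag; apply: eq_bigr => i _; rewrite !mxE.
rewrite mulr1 -sqr_normcE sqr_normc_cdot -rmorphB /= normc_conj !sqr_normc_cdot cdotBB.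
rewrite /coord_cost cdotBB -!sqr_normc_cdot normc_real real_normK ?num_real //.
have -> : coord_corner (u i 0) (v i 0) (y i 0) - (normc (u i 0) ^+ 2 -
    2 * cdot (u i 0) (v i 0) + normc (v i 0) ^+ 2) = y i 0 - normc (u i 0) ^+ 2.
  by rewrite /coord_corner -sqr_normc_cdot; ring.
rewrite !expr0n !addr0 !sqrtr_sqr normr1.
by congr (Num.sqrt (_ + _)); ring.
Qed.

(** * The one-coordinate minimization *)

(** The minimizer: v / 2 when the target modulus is 0, and otherwise the radial
    projection of v on the circle of radius sqrt t. *)
Definition coord_step (R : realType) (v : R[i]) (t : R) : R[i] :=
  (if t == 0 then 2^-1 else Num.sqrt t / normc v)%:C * v.

(** The point to which the iterates of [coord_step] converge from v. *)
Definition coord_limit (R : realType) (v : R[i]) (t : R) : R[i] :=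
  (if t == 0 then 0 else Num.sqrt t / normc v)%:C * v.

(** The relative tolerance 1/4 is small enough for [coord_step] to be the
    minimizer whenever t <= 1, see [cost_gt_circle]. *)
Definition near_circle (R : realType) (v : R[i]) (t : R) : Prop :=
  t = 0 \/ 0 < t <= 1 /\ `|normc v - Num.sqrt t| <= Num.sqrt t / 4.

Lemma near_circle_gt0 (R : realType) (v : R[i]) (t : R) :
  near_circle v t -> 0 < t -> 0 < normc v.
Proof.
move=> [->|[_ near_v]]; first by rewrite ltxx.
rewrite -sqrtr_gt0; move: near_v; rewrite ler_norml => /andP[]; lra.
Qed.

(** The case t = 0, with q = |u|^2, c = Re(conj(u) v), w = |v|^2: the two sides
    are the squared costs at v / 2 and at u, and the hypothesis says
    |u - v / 2|^2 > 0.  The cost grows at least by 4 |u - v / 2|^2. *)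
Lemma cost_gt_origin (R : realFieldType) (c q w : R) :
  0 < q - c + w / 4 ->
  1 + w < (w - 2 * c) ^+ 2 + 1 + 2 * (q - 2 * c + w) + 2 * q.
Proof.
move=> dist_gt0; rewrite -subr_gt0.
have -> : (w - 2 * c) ^+ 2 + 1 + 2 * (q - 2 * c + w) + 2 * q - (1 + w) =
  (w - 2 * c) ^+ 2 + 4 * (q - c + w / 4) by field.
by have := sqr_ge0 (w - 2 * c); lra.
Qed.

(** The case t = rho^2 > 0, with r = |v|, q = |u|^2, c = Re(conj(u) v): the two
    sides are the squared costs at the projection (rho / r) v and at u, and the
    last hypothesis says |r u - rho v|^2 > 0.  The squared cost is both
    (1 + p)^2 + 2 (|det| - det) and (1 - p)^2 + 4 |u - v|^2 + 2 (|det| + det), so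
    it is bounded below by (1 + p)^2 and by (1 - p)^2 + 4 |u - v|^2; the two
    bounds coincide at the projection, where det = 0. *)
Lemma cost_gt_circle (R : realFieldType) (rho r c q : R) :
  0 < rho <= 1 -> `|r - rho| <= rho / 4 ->
  0 < q * r ^+ 2 - 2 * (rho * r) * c + rho ^+ 2 * r ^+ 2 ->
  (1 + (rho - r) ^+ 2) ^+ 2 <
  (rho ^+ 2 + r ^+ 2 - 2 * c) ^+ 2 + 1 + 2 * (q - 2 * c + r ^+ 2)
  + 2 * `|rho ^+ 2 - q|.
Proof.
move=> /andP[rho_gt0 rho_le1]; rewrite ler_norml => /andP[r_ge r_le] dist_gt0.
have r_gt0 : 0 < r by lra.
(* If the component c / r of u along v is less than rho, then 1 + p already
   exceeds its value 1 + (rho - r)^2 at the projection. *)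
have [lt_c|le_c] := ltP c (rho * r).
  have := ler_norm (rho ^+ 2 - q).
  set p := rho ^+ 2 + r ^+ 2 - 2 * c => ge_norm.
  have lt_p : (rho - r) ^+ 2 < p by rewrite /p; nra.
  have p_ge0 := sqr_ge0 (rho - r).
  have : (1 + (rho - r) ^+ 2) ^+ 2 < (1 + p) ^+ 2 by nra.
  by rewrite /p in ge_norm *; nra.
(* Otherwise the second lower bound (1 - p)^2 + 4 |u - v|^2 is used: delta is the
   excess of u over the circle in the direction of v. *)
pose delta := c / r - rho.
have cE : c = (rho + delta) * r by rewrite /delta; field; rewrite gt_eqF.
have delta_ge0 : 0 <= delta by rewrite subr_ge0 ler_pdivlMr.
have r2_gt0 : 0 < r ^+ 2 by rewrite exprn_gt0.
have q_gt : rho ^+ 2 + 2 * rho * delta < q.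
  rewrite -subr_gt0 -(pmulr_lgt0 _ r2_gt0); move: dist_gt0; rewrite cE.
  by congr (0 < _); ring.
have := ler_norm (q - rho ^+ 2); rewrite distrC => ge_norm.
(* A quarter of the growth rate in delta at the projection; it equals rho when
   r = rho, and closeness of r to rho <= 1 keeps it nonnegative. *)
have slope_ge0 : 0 <= r * (1 - (rho - r) ^+ 2) + 2 * (rho - r).
  have : (rho - r) ^+ 2 <= 1 / 4 by nra.
  nra.
have lower : (1 - (rho ^+ 2 + r ^+ 2 - 2 * c)) ^+ 2 + 4 * (q - 2 * c + r ^+ 2) -
  (1 + (rho - r) ^+ 2) ^+ 2 =
  4 * delta * (r * (1 - (rho - r) ^+ 2) + 2 * (rho - r)) + 4 * (delta * r) ^+ 2 +
  4 * (q - rho ^+ 2 - 2 * rho * delta).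
  by rewrite cE; ring.
have := mulr_ge0 delta_ge0 slope_ge0.
have := sqr_ge0 (delta * r).
lra.
Qed.

Lemma coord_cost_step_lt (R : realType) (u v : R[i]) (t : R) :
  near_circle v t -> u != coord_step v t ->
  coord_cost (coord_step v t) v t < coord_cost u v t.
Proof.
move=> near_v neq_u.
suff : coord_corner (coord_step v t) v t ^+ 2 + 1 +
       2 * cdot (coord_step v t - v) (coord_step v t - v) +
       2 * `|t - cdot (coord_step v t) (coord_step v t)| <
       coord_corner u v t ^+ 2 + 1 + 2 * cdot (u - v) (u - v) +
       2 * `|t - cdot u u|.
  move=> lt_sqr; rewrite /coord_cost ltr_sqrt //; apply: le_lt_trans lt_sqr.
  by rewrite -!sqr_normc_cdot !addr_ge0 ?sqr_ge0 // mulr_ge0 ?sqr_ge0.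
have := cdot_gt0; move=> /(_ _ (u - coord_step v t)).
rewrite subr_eq0 => /(_ neq_u) {neq_u}.
rewrite /coord_corner !cdotBB /coord_step; set k := if _ then _ else _.
rewrite [cdot u (_ * _)]cdotC [cdot _ (_ * _)]cdotC !cdotZl.
rewrite [cdot _ (_ * _)]cdotC !cdotZl [cdot v u]cdotC {}/k.
case: near_v => [->|[t01 near_v]].
  rewrite eqxx => dist_gt0; rewrite !sub0r !add0r !normrN.
  have u2_ge0 : 0 <= cdot u u by rewrite -sqr_normc_cdot sqr_ge0.
  have v2_ge0 : 0 <= cdot v v by rewrite -sqr_normc_cdot sqr_ge0.
  rewrite (ger0_norm u2_ge0) ger0_norm; last by rewrite !mulr_ge0 ?invr_ge0.
  have /cost_gt_origin : 0 < cdot u u - cdot u v + cdot v v / 4.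
    by move: dist_gt0; congr (0 < _); field.
  by congr (_ < _); field.
have t_gt0 : 0 < t by case/andP: t01.
rewrite gt_eqF // -!(sqr_normc_cdot v).
set rho : R := Num.sqrt t in near_v *; set r : R := normc v in near_v *.
have tE : t = rho ^+ 2 by rewrite sqr_sqrtr // ltW.
have rho01 : 0 < rho <= 1.
  by case/andP: t01 => _ t_le1; rewrite sqrtr_gt0 t_gt0 -sqrtr1 ler_wsqrtr.
have r_gt0 : 0 < r by move: near_v; rewrite ler_norml => /andP[]; lra.
move=> dist_gt0.
have /(cost_gt_circle rho01 near_v) :
    0 < cdot u u * r ^+ 2 - 2 * (rho * r) * cdot u v + rho ^+ 2 * r ^+ 2.
  have := mulr_gt0 (exprn_gt0 2 r_gt0) dist_gt0; congr (0 < _).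
  by field; rewrite gt_eqF.
rewrite tE; congr (_ < _).
have -> : rho ^+ 2 - rho / r * (rho / r * r ^+ 2) = 0 by field; rewrite gt_eqF.
by rewrite normr0; field; rewrite gt_eqF.
Qed.

(** On a circle of positive radius the step reaches the limit at once, so the
    rate 1/2 comes from the coordinates with t = 0. *)
Lemma near_circle_step (R : realType) (v : R[i]) (t : R) :
  near_circle v t ->
  [/\ near_circle (coord_step v t) t,
      coord_limit (coord_step v t) t = coord_limit v t &
      normc (coord_step v t - coord_limit v t) <= 2^-1 * normc (v - coord_limit v t)].
Proof.
rewrite /coord_step /coord_limit => near_v; case: (near_v) => [->|[t01 _]].
  rewrite eqxx !mul0r !subr0 Normc.normcM normc_real ger0_norm ?invr_ge0 //.
  by split=> //; left.
have t_gt0 : 0 < t by case/andP: t01.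
rewrite gt_eqF //.
have r_gt0 := near_circle_gt0 near_v t_gt0.
have normK : normc ((Num.sqrt t / normc v)%:C * v) = Num.sqrt t.
  rewrite Normc.normcM normc_real ger0_norm ?divr_ge0 ?sqrtr_ge0 ?normc_ge0 //.
  by rewrite divfK // gt_eqF.
split.
- right; split=> //; rewrite normK.
  by rewrite subrr normr0 divr_ge0 ?sqrtr_ge0 ?ler0n.
- by rewrite normK divff ?gt_eqF ?sqrtr_gt0 // rmorph1 mul1r.
- by rewrite subrr Normc.normc0 mulr_ge0 ?invr_ge0 ?normc_ge0 ?ler0n.
Qed.

Lemma coord_limit_fixed (R : realType) (v : R[i]) (t : R) :
  near_circle v t ->
  [/\ near_circle (coord_limit v t) t,
      coord_step (coord_limit v t) t = coord_limit v t &
      normc (coord_limit v t) ^+ 2 = t].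
Proof.
move=> near_v; case: (near_v) => [->|[t01 _]].
  rewrite /coord_limit /coord_step eqxx mul0r mulr0 Normc.normc0 expr0n.
  by split=> //; left.
have t_gt0 : 0 < t by case/andP: t01.
have step_limit w : coord_step w t = coord_limit w t.
  by rewrite /coord_step /coord_limit gt_eqF.
have [near_lim limK _] := near_circle_step near_v.
rewrite step_limit in near_lim limK *; split; rewrite ?step_limit //.
have r_gt0 := near_circle_gt0 near_v t_gt0.
rewrite /coord_limit gt_eqF // Normc.normcM normc_real.
rewrite ger0_norm ?divr_ge0 ?sqrtr_ge0 ?normc_ge0 // divfK ?gt_eqF //.
by rewrite sqr_sqrtr // ltW.
Qed.

Lemma near_circle_of_close (R : realType) (v w : R[i]) :
  0 <= normc w ^+ 2 <= 1 ->
  (normc w != 0 -> normc (v - w) <= normc w / 4) ->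
  near_circle v (normc w ^+ 2).
Proof.
move=> /andP[_ w_le1]; have [-> _|w_neq0 /(_ isT) close] := eqVneq (normc w) 0.
  by left; rewrite expr0n.
have w_gt0 : 0 < normc w by rewrite lt0r w_neq0 normc_ge0.
right; rewrite exprn_gt0 // w_le1 sqrtr_sqr (ger0_norm (ltW w_gt0)); split=> //.
apply: le_trans close; rewrite -lecR -normc_real !normc_normE rmorphB /=.
rewrite !normc_normE; exact: ler_dist_dist.
Qed.

(** * Passing to vectors *)

Lemma l2norm_unitary (R : realType) (n : nat) (U : 'M[R[i]]_n)
    (x : 'cV[R[i]]_n) : U \is unitarymx -> l2norm (U *m x) = l2norm x.
Proof.
move=> U_unitary; rewrite /l2norm; congr Num.sqrt; apply: complexI.
have gram (z : 'cV[R[i]]_n) :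
    (\sum_i normc (z i ord0) ^+ 2)%:C = (z ^t* *m z) 0 0.
  rewrite rmorph_sum mxE; apply: eq_bigr => i _.
  by rewrite /= sqr_normcE !mxE.
rewrite !gram trmx_mul map_mxM mulmxA -(mulmxA (x ^t*)).
have UtU : U ^t* *m U = 1%:M by rewrite -invmx_unitary // mulVmx // unitarymx_unit.
by rewrite UtU mulmx1.
Qed.

Lemma normc_le_l2norm (R : realType) (n : nat) (x : 'cV[R[i]]_n) (i : 'I_n) :
  normc (x i 0) <= l2norm x.
Proof.
rewrite -(ger0_norm (normc_ge0 (x i 0))) -sqrtr_sqr ler_wsqrtr //.
rewrite (bigD1 i) //= lerDl; apply: sumr_ge0 => j _; exact: sqr_ge0.
Qed.

Lemma l2norm_le_scale (R : realType) (n : nat) (k : R) (x z : 'cV[R[i]]_n) :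
  0 <= k -> (forall i, normc (x i 0) <= k * normc (z i 0)) ->
  l2norm x <= k * l2norm z.
Proof.
move=> k_ge0 le_xz; rewrite -[k]ger0_norm // -sqrtr_sqr /l2norm.
rewrite -sqrtrM ?sqr_ge0 // ler_wsqrtr // mulr_sumr; apply: ler_sum => i _.
by rewrite -exprMn ler_sqr ?nnegrE ?mulr_ge0 ?normc_ge0.
Qed.

(** The COPR operator is single-valued near the data: the sum of the coordinate
    costs is bounded below by its value at the vector s of coordinate minimizers,
    with equality only when every coordinate is the minimizer, and s is attained
    because U is invertible. *)
Lemma copr_opP (R : realType) (n : nat) (U : 'M[R[i]]_n) (y : 'cV[R]_n)
    (a x : 'cV[R[i]]_n) :
  U \is unitarymx -> (forall i, near_circle ((U *m a) i 0) (y i 0)) ->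
  copr_op U y a x <-> forall i, (U *m x) i 0 = coord_step ((U *m a) i 0) (y i 0).
Proof.
move=> U_unitary near_a.
pose s : 'cV[R[i]]_n := \col_i coord_step ((U *m a) i 0) (y i 0).
have Us : U *m (invmx U *m s) = s by rewrite mulKVmx // unitarymx_unit.
have cost_leif z : nuclear_norm (copr_mx U (invmx U *m s) (- a) y) <=
    nuclear_norm (copr_mx U z (- a) y)
    ?= iff [forall i, (U *m z) i 0 == coord_step ((U *m a) i 0) (y i 0)].
  rewrite !nuclear_norm_copr_mx Us.
  have /leif_sum : forall i : 'I_n, true ->
      coord_cost (s i 0) ((U *m a) i 0) (y i 0) <=
      coord_cost ((U *m z) i 0) ((U *m a) i 0) (y i 0)
      ?= iff ((U *m z) i 0 == coord_step ((U *m a) i 0) (y i 0)).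
    move=> i _; rewrite mxE; have [->|neq] := eqVneq; first exact/leif_refl.
    have lt_cost := coord_cost_step_lt (near_a i) neq.
    by split; [exact: ltW | rewrite lt_eqF].
  by [].
split=> [min_x i|x_step z].
  have [le_sx eq_sx] := cost_leif x.
  have : nuclear_norm (copr_mx U (invmx U *m s) (- a) y) ==
         nuclear_norm (copr_mx U x (- a) y).
    by rewrite eq_le; apply/andP; split; [exact: le_sx | exact: min_x].
  by rewrite eq_sx => /forallP /(_ i) /eqP.
have -> : nuclear_norm (copr_mx U x (- a) y) =
          nuclear_norm (copr_mx U (invmx U *m s) (- a) y).
  apply/eqP; rewrite eq_sym (cost_leif x); apply/forallP => i.
  by rewrite x_step.
by have [] := cost_leif z.
Qed.

(** * Convergence *)

Theorem theorem5p2 (R : realType) (na : nat) (hna : (1 <= na)%N)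
    (U : 'M[R[i]]_na) (hU : U \is unitarymx)
    (y : 'cV[R]_na) (hy : forall i, 0 <= y i ord0 <= 1)
    (astar : 'cV[R[i]]_na) (hastar : abs2 (U *m astar) = y) :
  exists eps : R, 0 < eps /\
    forall a : nat -> 'cV[R[i]]_na,
      picard_seq (copr_op U y) a ->
      l2norm (a 0%N - astar) < eps ->
      exists atilde : 'cV[R[i]]_na,
        [/\ Fix (copr_op U y) atilde,
            abs2 (U *m atilde) = y
          & converges_linearly a atilde].
Proof.
pose vstar := U *m astar.
have yE i : y i 0 = normc (vstar i 0) ^+ 2 by rewrite -hastar mxE.
pose radius i : R := normc (vstar i 0) / 4.
(* Coordinates with y_i = 0 put no constraint on the starting point. *)
exists (\big[Num.min/1]_(i | normc (vstar i 0) != 0) radius i).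
split=> [|a picard_a close_a].
  elim/big_ind: _ => // [r1 r2 r1_gt0 r2_gt0|i nz].
    by rewrite lt_min r1_gt0.
  by rewrite divr_gt0 // lt0r nz normc_ge0.
pose v k := U *m a k.
have near0 i : near_circle (v 0%N i 0) (y i 0).
  rewrite yE; apply: near_circle_of_close; first by rewrite -yE.
  move=> nz; have -> : v 0%N i 0 - vstar i 0 = (U *m (a 0%N - astar)) i 0.
    by rewrite mulmxBr !mxE.
  apply: le_trans (normc_le_l2norm _ _) _; rewrite l2norm_unitary //.
  apply: le_trans (ltW close_a) _.
  by rewrite (bigD1 i) //= ge_min lexx.
pose vlim : 'cV[R[i]]_na := \col_i coord_limit (v 0%N i 0) (y i 0).
(* The limit is already determined by the starting point, since a step changes
   neither the argument of a coordinate nor, hence, its projection. *)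
have invariant k : forall i,
    [/\ near_circle (v k i 0) (y i 0),
        coord_limit (v k i 0) (y i 0) = vlim i 0 &
        normc ((v k - vlim) i 0) <= 2^-1 ^+ k * normc ((v 0%N - vlim) i 0)].
  elim: k => [|k IHk] i; first by rewrite expr0 mul1r [vlim i 0]mxE; split.
  have near_k j : near_circle (v k j 0) (y j 0) by case: (IHk j).
  have v_next : v k.+1 i 0 = coord_step (v k i 0) (y i 0).
    exact: (copr_opP (a k.+1) hU near_k).1 (picard_a k) i.
  have [_ lim_k dist_k] := IHk i.
  have [near_next lim_next dist_next] := near_circle_step (near_k i).
  rewrite v_next lim_next lim_k; split=> //.
  have subE j : (v j - vlim) i 0 = v j i 0 - vlim i 0 by rewrite !mxE.
  rewrite subE v_next -lim_k; apply: le_trans dist_next _.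
  rewrite exprS -mulrA ler_pM2l ?invr_gt0 // lim_k -subE.
  exact: dist_k.
have U_unit := unitarymx_unit hU.
have Ulim : U *m (invmx U *m vlim) = vlim by rewrite mulKVmx.
exists (invmx U *m vlim); split.
- have near_lim i : near_circle ((U *m (invmx U *m vlim)) i 0) (y i 0).
    by rewrite Ulim mxE; case: (coord_limit_fixed (near0 i)).
  apply/(copr_opP _ hU near_lim) => i; rewrite Ulim mxE.
  by case: (coord_limit_fixed (near0 i)) => _ ->.
- apply/colP => i; rewrite Ulim /abs2 mxE [vlim i 0]mxE.
  by case: (coord_limit_fixed (near0 i)).
exists (l2norm (v 0%N - vlim)), 2^-1; split.
- exact: sqrtr_ge0.
- by lra.
move=> k; rewrite mulrC -(l2norm_unitary _ hU) mulmxBr Ulim.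
apply: l2norm_le_scale => [|i]; first by rewrite exprn_ge0 ?invr_ge0.
by case: (invariant k i).
Qed.
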